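(* Let $d \in \mathbb{N}$, $\alpha \ge 0$, and let $\boldsymbol{\gamma} = \{\gamma_{\mathfrak{u}}\}_{\mathfrak{u}\subset\mathbb{N}}$ be positive weights. Let $C_2 > 0$ be a constant such that $|\mathcal{P}_m| \le C_2\, m/\ln(m)$ for all integers $m \ge 2$. For every integer $n \ge 2$ and any $\boldsymbol{z} \in \mathbb{Z}^d$, $$ e^{\mathrm{rms}}_{d,\alpha,\boldsymbol{\gamma}}\big(Q^{\mathrm{ran\text{-}pr}}_{d,n,\boldsymbol{z}}\big) \;\ge\; e^{\mathrm{ran}}_{d,\alpha,\boldsymbol{\gamma}}\big(Q^{\mathrm{ran\text{-}pr}}_{d,n,\boldsymbol{z}}\big) \;\ge\; \frac{\gamma_{\{1\}} \sqrt{\ln(n)}}{\sqrt{C_2}\, n^{\alpha+1/2}} $$ and $$ e^{\mathrm{rms}}_{d,\alpha,\boldsymbol{\gamma}}\big(Q^{\mathrm{ran\text{-}pr\text{-}sh}}_{d,n,\boldsymbol{z}}\big) \;\ge\; \frac{\gamma_{\{1\}} \sqrt{\ln(n)}}{\sqrt{C_2}\, n^{\alpha+1/2}}. $$ If the first component $z_1$ of $\boldsymbol{z}$ is coprime to all $p \in \mathcal{P}_n$, then also $$ e^{\mathrm{ran}}_{d,\alpha,\boldsymbol{\gamma}}\big(Q^{\mathrm{ran\text{-}pr\text{-}sh}}_{d,n,\boldsymbol{z}}\big) \;\ge\; \frac{\gamma_{\{1\}} \sqrt{\ln(n)}}{\sqrt{C_2}\, n^{\alpha+1/2}}. $$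
   Context: Notation: $\mathbb{N} = \{1,2,\ldots\}$. For an integer $n \ge 2$, $\mathcal{P}_n := \{ n/2 < p \le n : p \text{ prime}\}$. For $\boldsymbol{h} \in \mathbb{Z}^d$, $\mathrm{supp}(\boldsymbol{h}) := \{ j \in \{1,\ldots,d\} : h_j \ne 0\}$. Weights: $\boldsymbol{\gamma} = \{\gamma_{\mathfrak{u}}\}_{\mathfrak{u} \subset \mathbb{N}}$ is a family of positive numbers indexed by the (finite) subsets of $\mathbb{N}$. Define $$ r_{\alpha,\boldsymbol{\gamma}}(\boldsymbol{h}) := \gamma_{\mathrm{supp}(\boldsymbol{h})}^{-1} \prod_{j \in \mathrm{supp}(\boldsymbol{h})} |h_j|^{\alpha}, \qquad \boldsymbol{h} \in \mathbb{Z}^d. $$ Function space (Korobov space): $\mathcal{H}_{d,\alpha,\boldsymbol{\gamma}}$ is the set of (complex-valued) $f \in L_2([0,1]^d)$ with $\|f\|_{d,\alpha,\boldsymbol{\gamma}} < \infty$, where $\|f\|_{d,\alpha,\boldsymbol{\gamma}}^2 := \sum_{\boldsymbol{h} \in \mathbb{Z}^d} |\hat f(\boldsymbol{h})|^2 r_{\alpha,\boldsymbol{\gamma}}^2(\boldsymbol{h})$ and $\hat f(\boldsymbol{h}) := \int_{[0,1]^d} f(\boldsymbol{x}) \mathrm{e}^{-2\pi \mathrm{i}\, \boldsymbol{h}\cdot\boldsymbol{x}} \,\mathrm{d}\boldsymbol{x}$. The same definition is used for $\alpha = 0$. Where point evaluations are used, elements $f$ are understood as measurable functions defined everywhere on $[0,1)^d$;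 the suprema below may be $+\infty$. Integral: $I_d(f) := \int_{[0,1]^d} f(\boldsymbol{x}) \,\mathrm{d}\boldsymbol{x}$. Lattice rules: for $m \in \mathbb{N}$, $\boldsymbol{z} \in \mathbb{Z}^d$, $\boldsymbol{\Delta} \in [0,1)^d$, $Q_{d,m,\boldsymbol{z},\boldsymbol{\Delta}}(f) := \frac1m \sum_{k=0}^{m-1} f\big((\boldsymbol{z}k/m + \boldsymbol{\Delta}) \bmod 1\big)$ (mod 1 componentwise), and $Q_{d,m,\boldsymbol{z}} := Q_{d,m,\boldsymbol{z},\boldsymbol{0}}$. Randomised algorithms: $Q^{\mathrm{ran\text{-}pr}}_{d,n,\boldsymbol{z}}(f,\omega) := Q_{d,p,\boldsymbol{z}}(f)$ with $p = p(\omega)$ uniformly distributed on $\mathcal{P}_n$; $Q^{\mathrm{ran\text{-}pr\text{-}sh}}_{d,n,\boldsymbol{z}}(f,\omega) := Q_{d,p,\boldsymbol{z},\boldsymbol{\Delta}}(f)$, where $p$ is uniformly distributed on $\mathcal{P}_n$, $\boldsymbol{\Delta}$ is uniformly distributed on $[0,1)^d$, and $p$ and $\boldsymbol{\Delta}$ are independent. Error measures of a randomised algorithm $A$ (worst case expected, or randomised, error and worst case root mean square error): $$ e^{\mathrm{ran}}_{d,\alpha,\boldsymbol{\gamma}}(A) := \sup_{f \in \mathcal{H}_{d,\alpha,\boldsymbol{\gamma}},\ \|f\|_{d,\alpha,\boldsymbol{\gamma}} \le 1} \mathbb{E}_\omega\big[|A(f,\omega) - I_d(f)|\big], $$ $$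 e^{\mathrm{rms}}_{d,\alpha,\boldsymbol{\gamma}}(A) := \sup_{f \in \mathcal{H}_{d,\alpha,\boldsymbol{\gamma}},\ \|f\|_{d,\alpha,\boldsymbol{\gamma}} \le 1} \sqrt{\mathbb{E}_\omega\big[|A(f,\omega) - I_d(f)|^2\big]}. $$ *)

(* Defs.v *)
From HB Require Import structures.
From mathcomp Require Import all_boot all_order all_algebra finmap.
From mathcomp Require Import all_classical all_reals all_analysis.
From mathcomp Require Import complex.

Set Implicit Arguments.
Unset Strict Implicit.
Unset Printing Implicit Defensive.

Import Order.TTheory GRing.Theory Num.Theory.
Import numFieldNormedType.Exports.
Import ComplexField.Normc.

Local Open Scope classical_set_scope.
Local Open Scope ring_scope.
Local Open Scope complex_scope.

(* The iterated product of one-dimensional Lebesgue measures, on the product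
   sigma-algebra of [d.-tuple R], i.e. on the Borel sets of R^d. *)
Fixpoint lebesgue_tuple (R : realType) (d : nat) :
    set (d.-tuple (measurableTypeR R)) -> \bar R :=
  match d with
  | 0 => \d_([tuple])
  | d'.+1 => pushforward
      (@lebesgue_measure R \x @lebesgue_tuple R d')%E
      (fun u => [tuple of u.1 :: u.2])
  end.

Section lebesgue_tuple_measure.
Variable R : realType.

Let tcons d (u : measurableTypeR R * d.-tuple (measurableTypeR R)) :=
  [tuple of u.1 :: u.2].
Let tuncons d (t : d.+1.-tuple (measurableTypeR R)) :
    measurableTypeR R * d.-tuple (measurableTypeR R) :=
  (tnth t ord0, [tuple of behead t]).

Let measurable_tcons d : measurable_fun setT (@tcons d).
Proof. exact: measurable_cons. Qed.

Let measurable_tuncons d : measurable_fun setT (@tuncons d).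
Proof.
apply/measurable_fun_pairP; split; first exact: measurable_tnth.
exact: measurable_behead.
Qed.

Let tconsK d : cancel (@tcons d) (@tuncons d).
Proof. by move=> [x t]; congr (_, _); apply/val_inj. Qed.

Let lebesgue_tuple_bundled d :
  exists m : {sigma_finite_measure set (d.-tuple (measurableTypeR R)) -> \bar R},
    m = @lebesgue_tuple R d :> (_ -> _).
Proof.
elim: d => [|d [m mE]].
  by exists \d_([tuple] : 0.-tuple (measurableTypeR R)).
have mf := @measurable_tcons d.
pose leb : {sigma_finite_measure set _ -> \bar R} := @lebesgue_measure R.
pose mu : {measure set (d.+1.-tuple (measurableTypeR R)) -> \bar R} :=
  measure_function_pushforward__canonical__measure_function_Measure
    (leb \x m)%E mf.
have sf : sigma_finite setT mu.
  have /sigma_finiteP[F [TF ndF Foo]] := sigma_finiteT leb.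
  have /sigma_finiteP[G [TG ndG Goo]] := sigma_finiteT m.
  exists (fun n => @tuncons d @^-1` (F n `*` G n)) => [|k].
    rewrite -preimage_bigcup -[LHS](preimage_setT (@tuncons d)); congr (_ @^-1` _).
    apply/esym; rewrite -subTset => -[x y] _.
    have [n _ Fnx] : (\bigcup_i F i) x by rewrite -TF.
    have [p _ Gpy] : (\bigcup_i G i) y by rewrite -TG.
    exists (maxn n p) => //; split.
    - by move: x Fnx; exact/subsetPset/ndF/leq_maxl.
    - by move: y Gpy; exact/subsetPset/ndG/leq_maxr.
  have [mFk Fk] := Foo k; have [mGk Gk] := Goo k; split.
    rewrite -[X in measurable X]setTI; apply: (@measurable_tuncons d) => //.
    exact: measurableX.
  rewrite /mu /= /pushforward -comp_preimage.
  rewrite (_ : _ \o _ = id); last by apply/funext => u; exact: tconsK.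
  by rewrite preimage_id product_measure1E// lte_mul_pinfty// ge0_fin_numE.
pose sfm := Measure_isSigmaFinite.Build _ _ _ mu sf.
pose m' : {sigma_finite_measure set (d.+1.-tuple (measurableTypeR R)) -> \bar R} :=
  HB.pack (mu : set _ -> \bar R) (Measure.on mu) sfm.
by exists m'; rewrite /m' /= /mu mE.
Qed.

Let lebesgue_tuple0 d : @lebesgue_tuple R d set0 = 0%E.
Proof. by have [m <-] := lebesgue_tuple_bundled d; exact: measure0. Qed.

Let lebesgue_tuple_ge0 d A : (0 <= @lebesgue_tuple R d A)%E.
Proof. by have [m <-] := lebesgue_tuple_bundled d; exact: measure_ge0. Qed.

Let lebesgue_tuple_sigma_additive d : semi_sigma_additive (@lebesgue_tuple R d).
Proof.
by have [m <-] := lebesgue_tuple_bundled d; exact: measure_semi_sigma_additive.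
Qed.

HB.instance Definition _ d := isMeasure.Build _ _ _ (@lebesgue_tuple R d)
  (@lebesgue_tuple0 d) (@lebesgue_tuple_ge0 d) (@lebesgue_tuple_sigma_additive d).

Let lebesgue_tuple_sigma_finite d : sigma_finite setT (@lebesgue_tuple R d).
Proof. by have [m <-] := lebesgue_tuple_bundled d; exact: sigma_finiteT. Qed.

HB.instance Definition _ d := @Measure_isSigmaFinite.Build _ _ _
  (@lebesgue_tuple R d) (@lebesgue_tuple_sigma_finite d).

End lebesgue_tuple_measure.

Notation Rtuple R d := (d.-tuple (measurableTypeR R)).

Section korobov_space.
Variables (R : realType) (d : nat).
Implicit Types (f : Rtuple R d -> R[i]) (h z : d.-tuple int).

(* [0, 1)^d.  A function on [0, 1)^d is represented by a function on R^d whose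
   values outside the cube are never used. *)
Definition unit_cube : set (Rtuple R d) :=
  [set x | forall j : 'I_d, 0 <= tnth x j < 1].

Definition cube_integral f : R[i] :=
  (\int[@lebesgue_tuple R d]_(x in unit_cube) complex.Re (f x)) +i*
  (\int[@lebesgue_tuple R d]_(x in unit_cube) complex.Im (f x)).

Definition cube_L2 f : Prop :=
  [/\ measurable_fun unit_cube (fun x => complex.Re (f x)),
      measurable_fun unit_cube (fun x => complex.Im (f x)) &
      (\int[@lebesgue_tuple R d]_(x in unit_cube) (normc (f x) ^+ 2)%:E < +oo)%E].

(* exp(i t) for real t *)
Definition expi (t : R) : R[i] := cos t +i* sin t.

Definition fourier_coef f h : R[i] :=
  cube_integral (fun x =>
    f x * expi (- (2 * pi * \sum_(j < d) (tnth h j)%:~R * tnth x j))).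

(* Coordinates are numbered from 1 in the index sets of the weights. *)
Definition supp h : {fset nat} :=
  [fset (val j).+1 | j in 'I_d & tnth h j != 0]%fset.

Definition korobov_r (alpha : R) (gamma : {fset nat} -> R) h : R :=
  (gamma (supp h))^-1 *
  \prod_(j < d | tnth h j != 0) (`|tnth h j|%N%:R `^ alpha).

Definition korobov_norm alpha gamma f : \bar R :=
  sqrte (\esum_(h in [set: d.-tuple int])
    (normc (fourier_coef f h) ^+ 2 * korobov_r alpha gamma h ^+ 2)%:E).

Definition korobov_space alpha gamma : set (Rtuple R d -> R[i]) :=
  [set f | cube_L2 f /\ (korobov_norm alpha gamma f < +oo)%E].

Definition frac_part (x : R) : R := x - (Num.floor x)%:~R.

Definition lattice_rule (m : nat) z (Delta : Rtuple R d) f : R[i] :=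
  m%:R^-1 * \sum_(k < m)
    f [tuple frac_part ((tnth z j)%:~R * k%:R / m%:R + tnth Delta j) | j < d].

End korobov_space.

(* The primes p with n/2 < p <= n. *)
Definition prime_set (n : nat) : {fset nat} :=
  [fset p in iota 0 n.+1 | prime p && (n < 2 * p)%N]%fset.

Section randomised_algorithms.
Context {R : realType} {d : nat} {disp : measure_display}.
Context {Omega : measurableType disp}.

Definition randomised_algorithm : Type :=
  (Rtuple R d -> R[i]) -> Omega -> R[i].

Variable P : probability Omega R.

Definition err_ran (alpha : R) (gamma : {fset nat} -> R)
    (A : randomised_algorithm) : \bar R :=
  ereal_sup [set 'E_P[(fun w => normc (A f w - cube_integral f))%R]%E | f in
    [set f | korobov_space alpha gamma f /\
             (korobov_norm alpha gamma f <= 1)%E]].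

Definition err_rms (alpha : R) (gamma : {fset nat} -> R)
    (A : randomised_algorithm) : \bar R :=
  ereal_sup [set sqrte 'E_P[(fun w => normc (A f w - cube_integral f) ^+ 2)%R]%E | f in
    [set f | korobov_space alpha gamma f /\
             (korobov_norm alpha gamma f <= 1)%E]].

Definition uniform_fset (S : {fset nat}) (p : {RV P >-> nat}) : Prop :=
  forall q : nat, P (p @^-1` [set q]) = ((q \in S)%:R / #|` S|%:R)%:E.

Definition uniform_cube (Delta : {RV P >-> Rtuple R d}) : Prop :=
  forall B : set (Rtuple R d), measurable B ->
    P (Delta @^-1` B) = @lebesgue_tuple R d (B `&` @unit_cube R d).

Definition independent_RV d1 d2 (T1 : measurableType d1)
    (T2 : measurableType d2) (X : {RV P >-> T1}) (Y : {RV P >-> T2}) : Prop :=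
  forall (A : set T1) (B : set T2), measurable A -> measurable B ->
    P (X @^-1` A `&` Y @^-1` B) = (P (X @^-1` A) * P (Y @^-1` B))%E.

Definition Q_ran_pr (z : d.-tuple int) (p : Omega -> nat) :
    randomised_algorithm :=
  fun f w => lattice_rule (p w) z [tuple 0 | j < d] f.

Definition Q_ran_pr_sh (z : d.-tuple int) (p : Omega -> nat)
    (Delta : Omega -> Rtuple R d) : randomised_algorithm :=
  fun f w => lattice_rule (p w) z (Delta w) f.

End randomised_algorithms.

(* Main.v *)
Require Import Defs.
From mathcomp Require Import all_boot all_order all_algebra finmap.
From mathcomp Require Import all_classical all_reals all_analysis.
From mathcomp Require Import measurable_realfun complex ring lra zify.

(* The test functions are trigonometric polynomials in the first coordinate.  A
   lattice rule with m points maps exp(2 pi i k x_1) to exp(2 pi i k Delta_1) if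
   m divides k z_1, and to 0 otherwise.  Let f be c times the sum of
   exp(2 pi i q x_1) over q in P_n.  It has norm at most 1 for
   c = gamma_{1} / (|P_n|^(1/2) n^alpha), which is at least the stated bound.
   Since p divides p z_1, the unshifted rule has error at least c on f for every
   p in P_n; if p does not divide z_1, the term q = p alone survives and the
   shifted rule has error exactly c.

   Suppose that some prime of P_n divides z_1, and let S be the set of the
   primes q in P_n that do not divide z_1, so |S| + 1 <= |P_n|.  The
   polynomials c (sum_{q in S} exp(2 pi i q x_1) +- exp(2 pi i x_1)) still have
   error c at the primes of S; at the other primes of P_n their squared errors
   add up to at least 2 c^2 by the parallelogram law.  So one of the two has
   mean square error at least c^2. *)

Set Implicit Arguments.
Unset Strict Implicit.
Unset Printing Implicit Defensive.

Import Order.TTheory GRing.Theory Num.Theory.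
Import numFieldNormedType.Exports.
Import ComplexField.Normc.

Local Open Scope classical_set_scope.
Local Open Scope ring_scope.
Local Open Scope complex_scope.

(** * Exponentials on a lattice *)

Section expi.
Variable R : realType.
Implicit Types (x y : R) (k : int).

Lemma expi0 : expi 0 = 1 :> R[i].
Proof. by rewrite /expi cos0 sin0. Qed.

Lemma expiD x y : expi (x + y) = expi x * expi y.
Proof.
rewrite /expi cosD sinD /GRing.mul /= /ComplexField.mulc.
by congr (_ +i* _); rewrite addrC.
Qed.

Lemma normc_expi x : normc (expi x) = 1.
Proof. by rewrite /normc /expi cos2Dsin2 sqrtr1. Qed.

Lemma expiMn x n : expi (x *+ n) = expi x ^+ n.
Proof. by elim: n => [|n ih]; rewrite ?expi0// mulrS exprS expiD ih. Qed.

Lemma expi_2pi_int k : expi (2 * pi * k%:~R) = 1 :> R[i].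
Proof.
have h (n : nat) : expi (2 * pi * n%:R) = 1 :> R[i].
  rewrite mulr_natr expiMn [2 * pi]mulr_natl {1}/expi cos2pi sin2pi.
  by rewrite [_ +i* _](_ : _ = 1)// expr1n.
case: k => n; first exact: h.
rewrite NegzE mulrNz mulrN -[LHS]mul1r -[in LHS](h n.+1) -expiD.
by rewrite subrr expi0.
Qed.

Lemma expi_2piDint x k : expi (2 * pi * (x + k%:~R)) = expi (2 * pi * x).
Proof. by rewrite mulrDr expiD expi_2pi_int mulr1. Qed.

(** The real part is 1 - 2 sin(pi x)^2, and sin is positive on the open interval from 0 to pi. *)
Lemma expi_2pi_neq1 x : 0 < x < 1 -> expi (2 * pi * x) != 1.
Proof.
move=> /andP[x0 x1]; apply/eqP => -[].
rewrite -mulrA mulr_natl cos_mulr2n cos2sin2 => + _.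
have : 0 < sin (pi * x) :> R.
  by rewrite sin_gt0_pi// mulr_gt0 ?pi_gt0//= gtr_pMr ?pi_gt0.
by move=> /(exprn_gt0 2) h1 h2; lra.
Qed.

(** Orthogonality of characters modulo m. This is a geometric sum whose ratio [w] satisfies w^m = 1,
    so (w - 1) times the sum is 0; the sum can be nonzero only if w = 1, that is, if m divides k. *)
Lemma sum_expi_root (m : nat) k : (0 < m)%N ->
  \sum_(j < m) expi (2 * pi * (k%:~R * j%:R / m%:R)) =
  (if (m %| k)%Z then m%:R else 0) :> R[i].
Proof.
move=> m0; set w := expi (2 * pi * (k%:~R / m%:R) : R).
have mR0 : (m%:R : R) != 0 by rewrite pnatr_eq0 -lt0n.
under eq_bigr => j _.
  rewrite (_ : 2 * pi * _ = (2 * pi * (k%:~R / m%:R)) *+ j); last first.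
    by rewrite -[RHS]mulr_natr; field.
  rewrite expiMn -/w; over.
have mE : (Posz m)%:~R = m%:R :> R by [].
have wm : w ^+ m = 1.
  rewrite -expiMn (_ : _ *+ m = 2 * pi * k%:~R) ?expi_2pi_int//.
  by rewrite -[LHS]mulr_natr; field.
case: ifPn => [/dvdzP[q kE]|kNm].
  have -> : w = 1 by rewrite /w kE intrM mulfK ?expi_2pi_int.
  by under eq_bigr do rewrite expr1n; rewrite sumr_const card_ord.
have /eqP : (w - 1) * (\sum_(j < m) w ^+ j) = 0 by rewrite -subrX1 wm subrr.
rewrite mulf_eq0 => /orP[|/eqP//]; rewrite subr_eq0.
(* To see that [w] is not 1, reduce k modulo m: the integer quotient drops out of the phase, and the
   nonzero remainder over m lies strictly between 0 and 1. *)
rewrite /w (_ : k%:~R / m%:R = (k %% m)%Z%:~R / m%:R + (k %/ m)%Z%:~R :> R); last first.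
  rewrite {1}(divz_eq k m) intrD intrM mE.
  by field.
rewrite expi_2piDint; have := @expi_2pi_neq1 ((k %% m)%Z%:~R / m%:R).
have mR : 0 < m%:R :> R by rewrite ltr0n.
rewrite divr_gt0 ?ltr0z//; last by rewrite lt_def modz_ge0 ?andbT -?dvdz_mod0P//; lia.
rewrite ltr_pdivrMr// mul1r -mE ltr_int ltz_pmod//=.
by move=> /(_ isT) /negbTE ->.
Qed.

End expi.

Section trig_poly.
Variables (R : realType) (d : nat).

Definition trig_poly (i : 'I_d) (s : seq int) (a : int -> R) (x : Rtuple R d) :
    R[i] :=
  \sum_(k <- s) (a k)%:C * expi (2 * pi * (k%:~R * tnth x i)).

(** Aliasing. Taking fractional parts changes the phase of an integer frequency by a multiple of 2
    pi, so each exponential splits into its value at the shift times a character sum modulo m with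
    parameter k z_i. *)
Lemma lattice_rule_trig_poly (m : nat) (z : d.-tuple int) Delta i s a : (0 < m)%N ->
  lattice_rule m z Delta (trig_poly i s a) =
  trig_poly i [seq k <- s | (m %| k * tnth z i)%Z] a Delta.
Proof.
move=> m0; rewrite /lattice_rule /trig_poly exchange_big/= big_distrr/=.
rewrite big_filter [RHS]big_mkcond/=; apply: eq_bigr => k _.
have m0' : m%:R != 0 :> R[i] by rewrite pnatr_eq0 -lt0n.
have E (j : 'I_m) :
    expi (2 * pi *
      (k%:~R * frac_part ((tnth z i)%:~R * j%:R / m%:R + tnth Delta i))) =
    expi (2 * pi * (k%:~R * tnth Delta i)) *
    expi (2 * pi * ((k * tnth z i)%:~R * j%:R / m%:R)) :> R[i].
  rewrite -expiD -mulrDr; set u := _ + tnth Delta i.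
  rewrite -[RHS](expi_2piDint _ (- (k * Num.floor u))); congr (expi (_ * _)).
  by rewrite /frac_part intrN !intrM /u; ring.
under eq_bigr do rewrite tnth_mktuple E mulrA.
rewrite -mulr_sumr sum_expi_root// mulrC.
by case: ifP; rewrite ?mulr0 ?mul0r// mulfK.
Qed.

End trig_poly.

(** * Integrals of cosines over the unit cube *)

Section cube.
Variable R : realType.
Notation leb := (@lebesgue_measure R).

Lemma sin_Dint2pi (t : R) k : sin (t + 2 * pi * k%:~R) = sin t.
Proof.
have := expiD t (2 * pi * k%:~R); rewrite expi_2pi_int mulr1.
by case.
Qed.

Lemma continuous_cos_affine (t b : R) : continuous (fun x => cos (t + b * x)).
Proof.
move=> x; apply: (continuous_comp (f := fun x => t + b * x) (g := cos)).
  by apply: cvgD; [exact: cvg_cst|apply: cvgM; [exact: cvg_cst|exact: cvg_id]].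
exact: continuous_cos.
Qed.

(** For k nonzero the antiderivative sin(t + b x) / b with b = 2 pi k agrees at 0 and 1. The phase t
    lets one statement serve cosines and sines, and it absorbs the other coordinates in the
    induction on the dimension. *)
Lemma integral_cos_period (t : R) k :
  (\int[leb]_(x in `[0%R, 1%R[) (cos (t + 2 * pi * (k%:~R * x)))%:E =
   (if k == 0 then cos t else 0)%:E)%E.
Proof.
have [->|k0] := eqVneq k 0.
  under eq_integral do rewrite mul0r mulr0 addr0.
  rewrite integral_cst//= lebesgue_measure_itv/= lte_fin ltr01 oppr0.
  by rewrite adde0 mule1.
pose b : R := 2 * pi * k%:~R.
have b0 : b != 0.
  by rewrite !mulf_neq0 ?intr_eq0 ?pnatr_eq0// gt_eqF ?pi_gt0.
under eq_integral do rewrite mulrA -/b.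
rewrite integral_itv_bndo_bndc; last first.
  apply/measurable_EFinP; apply: measurable_funTS.
  by apply: continuous_measurable_fun; exact: continuous_cos_affine.
pose F (x : R) := b^-1 * sin (t + b * x).
have dF (x : R) : is_derive x 1 F (cos (t + b * x)).
  have dg : is_derive x 1 (fun y => t + b * y) b.
    by apply: is_derive_eq; rewrite add0r mul1r [_ *: _]mulr1.
  have h := @is_derive1_comp R sin (fun y => t + b * y) x _ _
    (is_derive_sin _) dg.
  apply: (is_derive_eq (is_deriveZ b^-1 h)).
  by rewrite /= [_ *: _]mulrC mulfK.
have cF : continuous F.
  by move=> x; apply: differentiable_continuous; apply/derivable1_diffP; have [] := dF x.
rewrite (@continuous_FTC2 _ (fun x => cos (t + b * x)) F)//.
- by rewrite /F mulr0 addr0 mulr1 sin_Dint2pi -EFinB subrr.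
- by apply: continuous_subspaceT; exact: continuous_cos_affine.
- split => //.
  + by apply: cvg_at_right_filter; exact: cF.
  + by apply: cvg_at_left_filter; exact: cF.
- by move=> x _; rewrite derive1E; apply: derive_val.
Qed.

Lemma measurable_unit_cube d : measurable (@unit_cube R d).
Proof.
rewrite (_ : @unit_cube R d = \bigcap_(i in [set: 'I_d])
   ((fun x : Rtuple R d => tnth x i) @^-1` `[0%R, 1%R[)).
  apply: fin_bigcap_measurable => [|i _]; first exact: finite_finset.
  rewrite -[X in measurable X]setTI.
  by apply: measurable_tnth => //; exact: measurable_itv.
apply/seteqP; split => x /= h i; first by rewrite /= in_itv/= => _; exact: h.
by move: (h i I); rewrite /= in_itv.
Qed.

Definition dotZ d (h : d.-tuple int) (x : Rtuple R d) : R :=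
  \sum_(j < d) (tnth h j)%:~R * tnth x j.

Lemma measurable_dotZ d (h : d.-tuple int) : measurable_fun setT (dotZ h).
Proof.
by apply: measurable_sum => j; apply: measurable_funM => //; exact: measurable_tnth.
Qed.

Lemma measurable_cos_dotZ d (h : d.-tuple int) (t : R) :
  measurable_fun setT (fun x => cos (t + 2 * pi * dotZ h x)).
Proof.
apply: (measurableT_comp (f := cos)).
  by apply: continuous_measurable_fun; exact: continuous_cos.
by apply: measurable_funD => //; apply: measurable_funM => //; exact: measurable_dotZ.
Qed.

Lemma preimage_cons_unit_cube d :
  (fun u : measurableTypeR R * Rtuple R d => [tuple of u.1 :: u.2]) @^-1`
    (@unit_cube R d.+1) = `[0%R, 1%R[ `*` @unit_cube R d.
Proof.
apply/seteqP; split => -[x y] /=.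
  move=> h; split; first by have := h ord0; rewrite in_itv/= tnth0.
  by move=> j; have := h (lift ord0 j); rewrite tnthS.
move=> [x01 h] j; case: (unliftP ord0 j) => [i ->|->].
  by rewrite tnthS; exact: h.
by move: x01; rewrite in_itv.
Qed.

Lemma lebesgue_tuple_unit_cube d : @lebesgue_tuple R d (@unit_cube R d) = 1%E.
Proof.
elim: d => [|d ih].
  by rewrite /= diracE mem_set// => -[].
rewrite /= /pushforward preimage_cons_unit_cube.
rewrite product_measure1E//=; last exact: measurable_unit_cube.
rewrite lebesgue_measure_itv/= lte_fin ltr01 oppr0 adde0 mul1e.
exact: ih.
Qed.

Lemma lebesgue_tuple_unit_cube_lty d :
  (@lebesgue_tuple R d (@unit_cube R d) < +oo)%E.
Proof. by rewrite lebesgue_tuple_unit_cube ltry. Qed.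

Lemma tuple_eq0_cons d (h : d.+1.-tuple int) :
  (h == [tuple 0 | _ < d.+1]) =
  (tnth h ord0 == 0) && ([tuple of behead h] == [tuple 0 | _ < d]).
Proof.
apply/eqP/andP => [->|[/eqP h0 /eqP h']].
  rewrite tnth_mktuple eqxx; split => //; apply/eqP/eq_from_tnth => i.
  by rewrite !tnth_mktuple tnth_behead tnth_mktuple.
apply/eq_from_tnth => j; case: (unliftP ord0 j) => [i ->|->]; rewrite tnth_mktuple//.
have := congr1 (fun u => tnth u i) h'; rewrite tnth_behead tnth_mktuple => <-.
by congr tnth; apply/val_inj; rewrite /= inordK// ltnS ltn_ord.
Qed.

Lemma dotZ_cons d (h : d.+1.-tuple int) (x : R) (y : Rtuple R d) :
  dotZ h [tuple of x :: y] =
  (tnth h ord0)%:~R * x + dotZ [tuple of behead h] y.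
Proof.
rewrite /dotZ big_ord_recl tnth0; congr (_ + _); apply: eq_bigr => j _.
by rewrite tnthS {1}(tuple_eta h) tnthS.
Qed.

(** Induction on d by Fubini. For a fixed first coordinate x the inner integral is the case of
    dimension d with phase t + 2 pi h_1 x, which is why t is generalised; the outer one is
    [integral_cos_period]. *)
Lemma integral_cos_cube d (h : d.-tuple int) (t : R) :
  (\int[@lebesgue_tuple R d]_(x in @unit_cube R d) (cos (t + 2 * pi * dotZ h x))%:E =
   (if h == [tuple 0 | _ < d] then cos t else 0)%:E)%E.
Proof.
elim: d h t => [|d ih] h t.
  rewrite integral_dirac//=; last first.
  - apply: measurable_funTS; apply/measurable_EFinP.
    exact: measurable_cos_dotZ.
  - exact: measurable_unit_cube.
  rewrite diracE mem_set; last by case.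
  by rewrite mul1e /dotZ big_ord0 mulr0 addr0 [h]tuple0 [X in _ == X]tuple0 eqxx.
pose phi (u : measurableTypeR R * Rtuple R d) : Rtuple R d.+1 :=
  [tuple of u.1 :: u.2].
have mphi : measurable_fun setT phi by exact: measurable_cons.
pose g (x : Rtuple R d.+1) := (cos (t + 2 * pi * dotZ h x))%:E.
have mg : measurable_fun setT g.
  by apply/measurable_EFinP; exact: measurable_cos_dotZ.
pose D : set (measurableTypeR R * Rtuple R d) :=
  `[0%R, 1%R[ `*` @unit_cube R d.
have preE : phi @^-1` (@unit_cube R d.+1) = D.
  exact: preimage_cons_unit_cube.
have mD : measurable D.
  by apply: measurableX; [exact: measurable_itv|exact: measurable_unit_cube].
have intg : (leb \x @lebesgue_tuple R d)%E.-integrable D (g \o phi).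
  apply: (@measurable_bounded_integrable _ _ _ _
    (fun u => cos (t + 2 * pi * dotZ h (phi u)))) => //.
  - suff : ((leb \x @lebesgue_tuple R d) D < +oo)%E by [].
    rewrite product_measure1E//=; last exact: measurable_unit_cube.
    rewrite lebesgue_measure_itv/= lte_fin ltr01 oppr0 adde0 mul1e.
    by rewrite lebesgue_tuple_unit_cube ltry.
  - apply: measurable_funTS; exact: measurableT_comp (measurable_cos_dotZ h t) mphi.
  - exists 1; split; rewrite ?num_real// => M M1 u _.
    exact: le_trans (cos_max _) (ltW M1).
(* The measure in dimension d + 1 is by definition an image of a product measure; the integral is
   pulled back to that product, where Fubini applies. *)
rewrite -[LHS]/(\int[pushforward (leb \x @lebesgue_tuple R d)%E phi]_(x in
  @unit_cube R d.+1) g x)%E.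
rewrite integral_pushforward// ?preE//; last exact: measurable_unit_cube.
rewrite integral_mkcond -integral12_prod_meas1; last first.
  by apply/(integrable_mkcond _ mD).
rewrite -[RHS]/((if h == [tuple 0 | _ < d.+1] then cos t else 0)%:E).
transitivity (\int[leb]_(x in `[0%R, 1%R[)
    (if [tuple of behead h] == [tuple 0 | _ < d] then
       cos (t + 2 * pi * ((tnth h ord0)%:~R * x)) else 0)%:E)%E.
  rewrite [RHS]integral_mkcond; apply: eq_integral => x _.
  rewrite /fubini_F /patch; case: ifPn => xI; last first.
    apply: integral0_eq => y _; rewrite ifF//; apply: contraNF xI.
    by rewrite !inE => -[].
  rewrite -ih [RHS]integral_mkcond; apply: eq_integral => y _; rewrite /patch.
  rewrite in_setX xI/=; case: ifP => // _.
  by rewrite /g /phi/= dotZ_cons mulrDr addrA.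
rewrite tuple_eq0_cons; case: eqVneq => [h0|hN0].
  by rewrite integral_cos_period andbT.
by rewrite andbF integral0_eq.
Qed.

End cube.

(** * Fourier coefficients and Korobov norm of trigonometric polynomials *)

Section fourier.
Variables (R : realType) (d : nat).
Implicit Types (h : d.-tuple int) (a : int -> R) (s : seq int) (i : 'I_d).
Notation mu := (@lebesgue_tuple R d).
Notation cube := (@unit_cube R d).
Notation zeros := [tuple (0 : int) | _ < d].

Lemma integrable_cos_dotZ h (t : R) :
  mu.-integrable cube (EFin \o (fun x => cos (t + 2 * pi * dotZ h x))).
Proof.
apply: measurable_bounded_integrable; first exact: measurable_unit_cube.
- exact: lebesgue_tuple_unit_cube_lty.
- by apply: measurable_funTS; exact: measurable_cos_dotZ.
- exists 1; split; rewrite ?num_real// => M M1 u _.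
  exact: le_trans (cos_max _) (ltW M1).
Qed.

Lemma integral_sum_cos_cube (I : Type) (s : seq I) (a : I -> R)
    (g : I -> d.-tuple int) (t : R) :
  \int[mu]_(x in cube) (\sum_(k <- s) a k * cos (t + 2 * pi * dotZ (g k) x)) =
  \sum_(k <- s) a k * (if g k == zeros then cos t else 0).
Proof.
rewrite /Rintegral; under eq_integral do rewrite -sumEFin.
rewrite integral_sum; first last.
- move=> k; under eq_fun do rewrite EFinM.
  by apply: integrableZl; [exact: measurable_unit_cube|exact: integrable_cos_dotZ].
- exact: measurable_unit_cube.
under eq_bigr => k _.
  under eq_integral do rewrite EFinM.
  rewrite integralZl; [|exact: measurable_unit_cube|exact: integrable_cos_dotZ].
  by rewrite integral_cos_cube -EFinM; over.
by rewrite sumEFin.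
Qed.

Lemma Re_sum_expi (I : Type) (s : seq I) (a t : I -> R) :
  complex.Re (\sum_(k <- s) (a k)%:C * expi (t k)) = \sum_(k <- s) a k * cos (t k).
Proof.
elim: s => [|k s ih]; first by rewrite !big_nil.
rewrite !big_cons -ih; case: (\sum_(_ <- s) _ * _) => u v /=.
by rewrite mul0r subr0.
Qed.

Lemma Im_sum_expi (I : Type) (s : seq I) (a t : I -> R) :
  complex.Im (\sum_(k <- s) (a k)%:C * expi (t k)) = \sum_(k <- s) a k * sin (t k).
Proof.
elim: s => [|k s ih]; first by rewrite !big_nil.
rewrite !big_cons -ih; case: (\sum_(_ <- s) _ * _) => u v /=.
by rewrite mul0r addr0.
Qed.

Lemma cube_integral_sum_expi (I : Type) (s : seq I) (a : I -> R)
    (g : I -> d.-tuple int) :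
  cube_integral (fun x : Rtuple R d =>
    \sum_(k <- s) (a k)%:C * expi (2 * pi * dotZ (g k) x)) =
  (\sum_(k <- s | g k == zeros) a k)%:C.
Proof.
rewrite /cube_integral; congr (_ +i* _).
  under [in LHS]eq_Rintegral => x _.
    rewrite Re_sum_expi; under eq_bigr do rewrite -[2 * _ * _]add0r; over.
  rewrite integral_sum_cos_cube cos0 [RHS]big_mkcond/=; apply: eq_bigr => k _.
  by case: ifP; rewrite ?mulr1 ?mulr0.
(* The sines are cosines with phase -pi/2, and even the zero frequencies contribute nothing since
   cos(-pi/2) = 0. *)
under [in LHS]eq_Rintegral => x _.
  rewrite Im_sum_expi; under eq_bigr do rewrite -cosBpihalf addrC; over.
rewrite integral_sum_cos_cube cosN cos_pihalf big1// => k _.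
by rewrite if_same mulr0.
Qed.

Definition freq i (k : int) : d.-tuple int := [tuple if j == i then k else 0 | j < d].

Lemma dotZ_freq i k (x : Rtuple R d) : dotZ (freq i k) x = k%:~R * tnth x i.
Proof.
rewrite /dotZ (bigD1 i)//= big1 ?addr0 ?tnth_mktuple ?eqxx// => j ji.
by rewrite tnth_mktuple (negbTE ji) mul0r.
Qed.

Lemma freq_inj i : injective (freq i).
Proof. by move=> k l /(congr1 (fun u => tnth u i)); rewrite !tnth_mktuple eqxx. Qed.

Lemma freq0 i : freq i 0 = zeros.
Proof. by apply: eq_from_tnth => j; rewrite !tnth_mktuple if_same. Qed.

Lemma cube_integral_trig_poly i s a : 0 \notin s ->
  cube_integral (trig_poly i s a) = 0.
Proof.
move=> s0; rewrite /trig_poly.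
under [X in cube_integral X]eq_fun do under eq_bigr do rewrite -dotZ_freq.
rewrite cube_integral_sum_expi -(freq0 i) big1_seq// => k /andP[/eqP/freq_inj -> ks].
by rewrite ks in s0.
Qed.

(** The factor exp(-2 pi i h.x) moves each frequency by -h, and the integral then keeps exactly the
    terms moved to 0. *)
Lemma fourier_coef_trig_poly i s a h :
  fourier_coef (trig_poly i s a) h = (\sum_(k <- s | freq i k == h) a k)%:C.
Proof.
rewrite /fourier_coef /trig_poly.
pose g k : d.-tuple int := [tuple tnth (freq i k) j - tnth h j | j < d].
transitivity (cube_integral (fun x : Rtuple R d =>
    \sum_(k <- s) (a k)%:C * expi (2 * pi * dotZ (g k) x))).
  congr cube_integral; apply/funext => x; rewrite mulr_suml; apply: eq_bigr => k _.
  rewrite -mulrA -expiD -dotZ_freq -mulrBr; congr (_ * expi (_ * _)).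
  rewrite /dotZ -sumrB; apply: eq_bigr => j _.
  by rewrite !tnth_mktuple intrB mulrBl.
rewrite cube_integral_sum_expi; congr (_%:C); apply: eq_bigl => k.
apply/eqP/eqP => [gk|kh]; apply: eq_from_tnth => j; last first.
  by rewrite tnth_mktuple kh subrr tnth_mktuple.
move/(congr1 (fun u => tnth u j)): gk; rewrite !tnth_mktuple => /eqP.
by rewrite subr_eq0 => /eqP.
Qed.

Lemma fourier_coef_trig_poly_freq i s a k : uniq s -> k \in s ->
  fourier_coef (trig_poly i s a) (freq i k) = (a k)%:C.
Proof.
move=> us ks; rewrite fourier_coef_trig_poly; congr (_%:C).
rewrite (eq_bigl (pred1 k)); last by move=> l /=; rewrite (inj_eq (@freq_inj i)).
by rewrite -big_filter filter_pred1_uniq// big_seq1.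
Qed.

(** The Fourier coefficients vanish off the image of [s] under [freq i], so the sum over Z^d is
    finite; since [s] has no repetitions, each coefficient is a single [a k]. *)
Lemma korobov_norm_trig_poly alpha gamma i s a : uniq s ->
  korobov_norm alpha gamma (trig_poly i s a) =
  sqrte (\sum_(k <- s) (a k ^+ 2 * korobov_r alpha gamma (freq i k) ^+ 2)%:E)%E.
Proof.
move=> us; rewrite /korobov_norm; congr (sqrte _).
transitivity (\esum_(h in freq i @` [set` s])
  (normc (fourier_coef (trig_poly i s a) h) ^+ 2 * korobov_r alpha gamma h ^+ 2)%:E)%E.
  rewrite [RHS]esum_mkcond; apply: eq_esum => h _; case: ifPn => // hs.
  rewrite fourier_coef_trig_poly big1_seq ?normc0 ?expr0n ?mul0r// => k /andP[/eqP kh ks].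
  by exfalso; move/negP: hs; apply; rewrite inE; exists k.
rewrite esum_image; last by move=> k l _ _; exact: freq_inj.
rewrite esum_fset; last 2 first.
- exact: finite_seq.
- by move=> k _; rewrite lee_fin mulr_ge0 ?sqr_ge0.
rewrite -fsbig_seq//; apply: eq_big_seq => k ks.
by rewrite fourier_coef_trig_poly_freq// /normc/= expr0n addr0 sqr_sqrtr ?sqr_ge0.
Qed.

Lemma supp_freq i k : k != 0 -> supp (freq i k) = [fset i.+1]%fset.
Proof.
move=> k0; apply/fsetP => u; rewrite inE; apply/imfsetP/eqP => /=.
  move=> [j]; rewrite inE tnth_mktuple; have [-> _ ->//|] := eqVneq j i.
  by rewrite eqxx.
by move=> ->; exists i; rewrite // inE tnth_mktuple eqxx.
Qed.

Lemma korobov_r_freq alpha gamma i k : k != 0 ->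
  korobov_r alpha gamma (freq i k) =
  (gamma [fset i.+1]%fset)^-1 * `|k|%N%:R `^ alpha :> R.
Proof.
move=> k0; rewrite /korobov_r supp_freq//; congr (_ * _).
rewrite (big_pred1 i) => [|j]; rewrite tnth_mktuple ?eqxx//.
by case: (eqVneq j i) => ji /=; rewrite ?k0 ?eqxx ?ji ?eqxx// (negbTE ji).
Qed.

Lemma measurable_Re_trig_poly i s a :
  measurable_fun setT (fun x => complex.Re (trig_poly i s a x)).
Proof.
rewrite /trig_poly; under eq_fun => x.
  rewrite Re_sum_expi; under eq_bigr do rewrite -dotZ_freq -[2 * _ * _]add0r.
  over.
apply: measurable_sum => k; apply: measurable_funM => //; exact: measurable_cos_dotZ.
Qed.

Lemma measurable_Im_trig_poly i s a :
  measurable_fun setT (fun x => complex.Im (trig_poly i s a x)).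
Proof.
rewrite /trig_poly; under eq_fun => x.
  rewrite Im_sum_expi; under eq_bigr do rewrite -dotZ_freq -cosBpihalf addrC.
  over.
apply: measurable_sum => k; apply: measurable_funM => //; exact: measurable_cos_dotZ.
Qed.

Lemma normc_sqr (u : R[i]) : normc u ^+ 2 = complex.Re u ^+ 2 + complex.Im u ^+ 2.
Proof. by case: u => u v; rewrite /normc/= sqr_sqrtr// addr_ge0 ?sqr_ge0. Qed.

Lemma normc_ge0 (u : R[i]) : 0 <= normc u.
Proof. by case: u => u v; exact: sqrtr_ge0. Qed.

Lemma normc_trig_poly_le i s a x : normc (trig_poly i s a x) <= \sum_(k <- s) `|a k|.
Proof.
rewrite /trig_poly; elim: s => [|k s ih]; first by rewrite !big_nil normc0.
rewrite !big_cons (le_trans (le_normcD _ _))// lerD// normcM normc_expi mulr1.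
by rewrite /normc/= expr0n addr0 sqrtr_sqr.
Qed.

Lemma cube_L2_trig_poly i s a : cube_L2 (trig_poly i s a).
Proof.
split.
- by apply: measurable_funTS; exact: measurable_Re_trig_poly.
- by apply: measurable_funTS; exact: measurable_Im_trig_poly.
have : mu.-integrable cube (EFin \o (fun x => normc (trig_poly i s a x) ^+ 2)).
  apply: measurable_bounded_integrable; first exact: measurable_unit_cube.
  - exact: lebesgue_tuple_unit_cube_lty.
  - apply: measurable_funTS; under eq_fun do rewrite normc_sqr.
    by apply: measurable_funD; apply: measurable_funX;
      [exact: measurable_Re_trig_poly|exact: measurable_Im_trig_poly].
  - exists ((\sum_(k <- s) `|a k|) ^+ 2); split; rewrite ?num_real// => M SM x _.
    rewrite /= ger0_norm ?sqr_ge0// (le_trans _ (ltW SM))// lerXn2r ?nnegrE ?normc_ge0//.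
      by rewrite sumr_ge0.
    exact: normc_trig_poly_le.
move=> /integrableP[_]; apply: le_lt_trans.
under [X in (_ <= X)%E]eq_integral do rewrite /= ger0_norm ?sqr_ge0//.
by [].
Qed.

(** Each frequency contributes (1/N) (|k|/n)^(2 alpha), at most 1/N, and there are at most N of
    them. Only squares of coefficients enter, so any choice of signs is allowed. *)
Lemma korobov_norm_trig_poly_le1 alpha gamma i s a (c : R) (n N : nat) :
  0 <= alpha -> 0 < gamma [fset i.+1]%fset -> (0 < N)%N ->
  c = gamma [fset i.+1]%fset / (Num.sqrt N%:R * n%:R `^ alpha) ->
  uniq s -> (size s <= N)%N ->
  (forall k, k \in s -> a k ^+ 2 = c ^+ 2 /\ (0 < `|k| <= n)%N) ->
  (korobov_norm alpha gamma (trig_poly i s a) <= 1)%E.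
Proof.
move=> al0 g0 N0 cE us sN sP; rewrite korobov_norm_trig_poly//.
suff : (\sum_(k <- s) (a k ^+ 2 * korobov_r alpha gamma (freq i k) ^+ 2)%:E <= 1)%E.
  rewrite sumEFin lee_fin => h /=.
  by rewrite lee_fin -[leRHS]sqrtr1 ler_wsqrtr.
rewrite sumEFin lee_fin.
apply: (@le_trans _ _ (\sum_(k <- s) N%:R^-1)); last first.
  rewrite big_const_seq count_predT iter_addr_0 -[_ *+ size s]mulr_natl.
  by rewrite ler_pdivrMr ?ltr0n// mul1r ler_nat.
rewrite big_seq [leRHS]big_seq; apply: ler_sum => k ks.
have [-> /andP[k0 kn]] := sP _ ks.
have n0 : (0 < n)%N by exact: leq_trans kn.
rewrite korobov_r_freq -?absz_gt0// -exprMn cE.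
have p0 : 0 < n%:R `^ alpha :> R by apply: powR_gt0; rewrite ltr0n.
rewrite (_ : _ / _ * _ =
  Num.sqrt N%:R^-1 * (`|k|%N%:R `^ alpha / n%:R `^ alpha)); last first.
  rewrite sqrtrV ?ler0n//.
  by field; rewrite ?gt_eqF// sqrtr_gt0 ltr0n.
rewrite exprMn sqr_sqrtr ?invr_ge0// ler_piMr ?invr_ge0//.
apply: exprn_ile1; first by rewrite divr_ge0 ?powR_ge0.
by rewrite ler_pdivrMr// mul1r ge0_ler_powR ?nnegrE ?ler0n ?ler_nat.
Qed.

End fourier.

(** * Expectations *)

Section expectation.
Context d (Omega : measurableType d) (R : realType) (P : probability Omega R).
Implicit Types X Y : Omega -> R.
Local Open Scope ereal_scope.

(* The integral of a nonnegative function is a supremum over the simple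
   functions below it, hence no measurability is needed. *)
Lemma ge0_le_expectation X Y : (forall w, (0 <= X w <= Y w)%R) ->
  'E_P[X] <= 'E_P[Y].
Proof.
move=> XY; have X0 w : (0 <= X w)%R by have /andP[] := XY w.
have Y0 w : (0 <= Y w)%R by have /andP[/le_trans] := XY w; apply.
rewrite unlock !ge0_integralTE; [|by move=> w; rewrite lee_fin..].
apply: ereal_sup_le => _ [h hX <-]; exists h => //.
by move=> w; rewrite (le_trans (hX w))// lee_fin; have /andP[] := XY w.
Qed.

(** X dominates c times the indicator of A, whose expectation is c P(A) = c. *)
Lemma expectation_ge_cst X (c : R) (A : set Omega) :
  measurable A -> P A = 1 -> (0 <= c)%R ->
  (forall w, (0 <= X w)%R) -> (forall w, A w -> (c <= X w)%R) -> c%:E <= 'E_P[X].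
Proof.
move=> mA PA c0 X0 cX.
apply: (@le_trans _ _ 'E_P[(fun w => c * \1_A w)%R]); last first.
  apply: ge0_le_expectation => w; rewrite mulr_ge0//= indicE.
  have [wA|wA] := boolP (w \in A); last by rewrite mulr0.
  by rewrite mulr1 cX// -inE.
rewrite unlock; under eq_integral do rewrite EFinM.
rewrite ge0_integralZl//; last by apply/measurable_EFinP; exact: measurable_indic.
by rewrite integral_indic// setIT [X in _ * X]PA mule1.
Qed.

(** Cauchy-Schwarz against the constant 1, which has L2 norm 1 under a probability. *)
Lemma expectation_le_sqrte X : measurable_fun setT X -> (forall w, (0 <= X w)%R) ->
  'E_P[X] <= sqrte 'E_P[(fun w => X w ^+ 2)%R].
Proof.
move=> mX X0.
have := @hoelder _ _ _ P X (cst 1%R) 2 2 mX (@measurable_cst _ _ _ _ _ _).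
have h2 : (2^-1 + 2^-1 = 1 :> R)%R by field.
move=> /(_ (ltr0n _ 2) (ltr0n _ 2) h2).
have -> : Lnorm P 2 (EFin \o cst 1%R) = 1.
  by rewrite Lnorm_cst1 [X in X `^ _]probability_setT poweR1r.
rewrite mule1 Lnorm1.
rewrite [in X in _ <= X -> _]unlock poweR12_sqrt; last first.
  by apply: integral_ge0 => w _; exact: poweR_ge0.
rewrite !unlock.
under eq_integral do rewrite /= mulr1 ger0_norm//.
under [X in _ <= sqrte X -> _]eq_integral => w _.
  rewrite /= ger0_norm// powR_mulrn//.
  over.
by [].
Qed.

(** The values of [p] are countably many, so a preimage is a countable union of its slices on the
    events p = m. *)
Lemma measurable_fun_index (p : {RV P >-> nat}) (F : nat -> Omega -> R) :
  (forall m, measurable_fun setT (F m)) ->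
  measurable_fun setT (fun w => F (p w) w).
Proof.
move=> mF _ B mB; rewrite setTI.
rewrite (_ : _ @^-1` _ = \bigcup_m (p @^-1` [set m] `&` F m @^-1` B)).
  apply: bigcupT_measurable => m; apply: measurableI.
    by rewrite -[X in measurable X]setTI; exact: measurable_funPT.
  by rewrite -[X in measurable X]setTI; exact: mF.
by apply/seteqP; split => w /=; [exists (p w)|move=> [m _ [/= -> ]]].
Qed.

(** [uniform_fset] prescribes only the probabilities of points; the complement of [S] is a countable
    union of null points. *)
Lemma uniform_fset_prob1 (S : {fset nat}) (p : {RV P >-> nat}) :
  uniform_fset S p -> P (p @^-1` [set` S]) = 1.
Proof.
move=> pS.
have mp B : measurable (p @^-1` B).
  by rewrite -[X in measurable X]setTI; exact: measurable_funPT.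
have nP : P.-negligible (\bigcup_q (p @^-1` ([set q] `\` [set` S]))).
  apply: negligible_bigcup => q; apply/negligibleP => //.
  have [qS|qS] := boolP (q \in S).
    rewrite (_ : _ `\` _ = set0) ?preimage_set0 ?measure0//.
    by apply/seteqP; split => // r /= [->].
  rewrite (_ : _ `\` _ = [set q]); first by rewrite [LHS]pS (negbTE qS) mul0r.
  apply/seteqP; split => r /=; first by case.
  by move=> ->; split => //; apply/negP.
have : P (~` (p @^-1` [set` S])) = 0.
  apply: measure_negligible; first exact/measurableC.
  by apply: negligibleS nP => w /= pw; exists (p w).
rewrite probability_setC// => /eqP; rewrite sube_eq ?fin_num_measure//.
by rewrite add0e => /eqP <-.
Qed.

(** The mere existence of a uniform variable forces [S] to be nonempty. Applied to P_n, this takes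
    the place of Bertrand's postulate. *)
Lemma uniform_fset_gt0 (S : {fset nat}) (p : {RV P >-> nat}) :
  uniform_fset S p -> (0 < #|` S|)%N.
Proof.
move=> pS; rewrite cardfs_gt0; apply/negP => /eqP S0.
have := uniform_fset_prob1 pS.
have -> : p @^-1` [set` S] = set0 by apply/seteqP; split => // w /=; rewrite S0.
move=> P01; have : (0 : \bar R) = 1 by rewrite -P01 [RHS]measure0.
by move=> /eqP; rewrite eqe eq_sym oner_eq0.
Qed.

End expectation.

(** * Errors of lattice rules on trigonometric polynomials *)

Section lattice_errors.
Variables (R : realType) (d : nat).
Implicit Types (z : d.-tuple int) (i : 'I_d) (s : seq int) (x : Rtuple R d).

Lemma normc_real (c : R) : normc c%:C = `|c|.
Proof. by rewrite /normc/= expr0n addr0 sqrtr_sqr. Qed.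

(** Without a shift every surviving exponential equals 1, so the rule returns c times the number of
    survivors, and the frequency m is one of them. *)
Lemma le_normc_lattice_rule_unshifted (m : nat) z i s (c : R) : (0 < m)%N -> 0 <= c ->
  Posz m \in s ->
  c <= normc (lattice_rule m z [tuple 0 | _ < d] (trig_poly i s (fun=> c))).
Proof.
move=> m0 c0 ms; rewrite lattice_rule_trig_poly//.
have : Posz m \in [seq k <- s | (m %| k * tnth z i)%Z].
  by rewrite mem_filter ms andbT dvdz_mulr.
move: [seq k <- s | _] => s' ms'.
rewrite /trig_poly tnth_mktuple; under eq_bigr do rewrite !mulr0 expi0 mulr1.
rewrite big_const_seq count_predT iter_addr_0 normcMn normc_real ger0_norm//.
by rewrite -[leLHS]mulr1n ler_wpMn2l//; case: (s') ms'.
Qed.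

(** Only the frequency m survives, and its exponential has modulus 1 whatever the shift, so the
    value holds for each shift and not just on average. *)
Lemma normc_lattice_rule_single (m : nat) z Delta i s (a : int -> R) : (0 < m)%N ->
  uniq s -> Posz m \in s ->
  {in s, forall k, (m %| k * tnth z i)%Z -> k = m} ->
  normc (lattice_rule m z Delta (trig_poly i s a)) = `|a m|.
Proof.
move=> m0 us ms sm; rewrite lattice_rule_trig_poly//.
rewrite (_ : [seq k <- s | _] = [:: Posz m]).
  by rewrite /trig_poly big_seq1 normcM normc_expi mulr1 normc_real.
rewrite -(filter_pred1_uniq us ms); apply: eq_in_filter => k ks /=.
by apply/idP/eqP => [/sm ->//|->]; rewrite dvdz_mulr.
Qed.

(** By the parallelogram law the two sides differ by twice the squared modulus of v. *)
Lemma parallelogram_ge (u v : R[i]) :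
  2 * normc u ^+ 2 <= normc (u + v) ^+ 2 + normc (- u + v) ^+ 2.
Proof.
case: u v => [u1 u2] [v1 v2]; rewrite !normc_sqr /=.
by rewrite -subr_ge0 (_ : _ - _ = 2 * (v1 ^+ 2 + v2 ^+ 2)); [nra|ring].
Qed.

Lemma measurable_normc_lattice_rule_trig_poly (m : nat) z i s (a : int -> R)
    (disp : measure_display) (Omega : measurableType disp) (Delta : Omega -> Rtuple R d) :
  measurable_fun setT Delta ->
  measurable_fun setT
    (fun w => normc (lattice_rule m z (Delta w) (trig_poly i s a)) ^+ 2).
Proof.
move=> mD; case: m => [|m].
  (* For m = 0 the sum is empty and the rule is constantly 0; the case arises because
     [measurable_fun_index] ranges over all naturals. *)
  rewrite (_ : (fun _ => _) = cst (normc (0 : R[i]) ^+ 2))//.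
  by apply/funext => w; rewrite /lattice_rule big_ord0 mulr0.
rewrite (_ : (fun _ => _) = (fun w =>
    complex.Re (trig_poly i [seq k <- s | (m.+1 %| k * tnth z i)%Z] a (Delta w)) ^+ 2 +
    complex.Im (trig_poly i [seq k <- s | (m.+1 %| k * tnth z i)%Z] a (Delta w)) ^+ 2)).
  apply: measurable_funD; apply: measurable_funX.
    exact: measurableT_comp (measurable_Re_trig_poly _ _ _) mD.
  exact: measurableT_comp (measurable_Im_trig_poly _ _ _) mD.
by apply/funext => w; rewrite lattice_rule_trig_poly// normc_sqr.
Qed.

Lemma korobov_ball_trig_poly alpha gamma i s (a : int -> R) :
  (korobov_norm alpha gamma (trig_poly i s a) <= 1)%E ->
  korobov_space alpha gamma (trig_poly i s a) /\
  (korobov_norm alpha gamma (trig_poly i s a) <= 1)%E.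
Proof.
move=> le1; split => //; split; first exact: cube_L2_trig_poly.
by rewrite (le_lt_trans le1) ?ltry.
Qed.

End lattice_errors.

(** * Divisibility by the primes of P_n *)

Lemma prime_setP n q : q \in prime_set n -> prime q /\ (q <= n)%N.
Proof.
rewrite !inE mem_iota ltnS => /and3P[q_le pq _]; split=> //.
by case/orP: q_le => [/eqP ->|/andP[]].
Qed.

Lemma prime_dvdz_mul (q k : nat) (z : int) : prime q -> prime k ->
  ~~ (q %| z)%Z -> (q %| Posz k * z)%Z -> k = q.
Proof.
move=> pq pk qz; rewrite !dvdzE in qz *; rewrite abszM Euclid_dvdM//= (negbTE qz).
by rewrite orbF dvdn_prime2// => /eqP.
Qed.

Lemma prime_ndvdz_of_coprimez (q : nat) (z : int) :
  prime q -> coprimez z q -> ~~ (q %| z)%Z.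
Proof. by move=> pq; rewrite coprimezE dvdzE /= coprime_sym prime_coprime. Qed.

(** * Size of the coefficients of the test functions *)

Section rates.
Variable R : realType.

(** The constant c of the test functions, for g = gamma_{1} and N = |P_n|. *)
Definition amplitude (alpha g : R) (N n : nat) : R := g / (Num.sqrt N%:R * n%:R `^ alpha).

(** After cancelling g and n^alpha this is the square root of N ln(n) <= C2 n, the assumed bound on
    the number of primes. *)
Lemma bound_le_amplitude (alpha g C2 : R) (N n : nat) : 0 < g -> 0 < C2 ->
  (0 < N)%N -> (2 <= n)%N -> N%:R <= C2 * n%:R / ln n%:R ->
  g * Num.sqrt (ln n%:R) / (Num.sqrt C2 * n%:R `^ (alpha + 2^-1)) <=
  amplitude alpha g N n.
Proof.
move=> g0 C0 N0 n2 NC.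
have n0 : 0 < n%:R :> R by rewrite ltr0n (leq_trans _ n2).
have ln0 : 0 < ln n%:R :> R by rewrite ln_gt0// ltr1n.
have N0' : 0 < N%:R :> R by rewrite ltr0n.
have p0 : 0 < n%:R `^ alpha :> R by exact: powR_gt0.
have -> : n%:R `^ (alpha + 2^-1) = n%:R `^ alpha * Num.sqrt n%:R :> R.
  by rewrite powRD ?powR12_sqrt ?ltW// [n%:R == 0]gt_eqF ?implybT.
rewrite /amplitude.
have h : Num.sqrt (ln n%:R) * Num.sqrt N%:R <= Num.sqrt C2 * Num.sqrt n%:R :> R.
  rewrite -(sqrtrM _ (ltW ln0)) -(sqrtrM _ (ltW C0)) ler_wsqrtr// mulrC.
  by rewrite -ler_pdivlMr.
rewrite ler_pdivrMr ?mulr_gt0 ?sqrtr_gt0// mulrAC ler_pdivlMr ?mulr_gt0 ?sqrtr_gt0//.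
set X := Num.sqrt _ in h *; set Y := Num.sqrt _ in h *.
set U := Num.sqrt _ in h *; set V := Num.sqrt _ in h *.
have := ler_wpM2l (ltW (mulr_gt0 g0 p0)) h.
by congr (_ <= _); ring.
Qed.

End rates.

(** * Bounding the suprema from below, and comparing the two error measures *)

Section error_measures.
Context (R : realType) (d : nat) (disp : measure_display).
Context (Omega : measurableType disp) (P : probability Omega R).
Variables (alpha : R) (gamma : {fset nat} -> R).
Implicit Types (A : @randomised_algorithm R d disp Omega) (f : Rtuple R d -> R[i]).
Local Open Scope ereal_scope.

Lemma le_err_ran A f (y : \bar R) :
  korobov_space alpha gamma f /\ korobov_norm alpha gamma f <= 1 ->
  y <= 'E_P[(fun w => normc (A f w - cube_integral f))%R] ->
  y <= err_ran P alpha gamma A.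
Proof. by move=> fP yE; apply: (le_trans yE); apply: ereal_sup_ubound; exists f. Qed.

Lemma le_err_rms A f (y : R) :
  korobov_space alpha gamma f /\ korobov_norm alpha gamma f <= 1 -> (0 <= y)%R ->
  (y ^+ 2)%:E <= 'E_P[(fun w => normc (A f w - cube_integral f) ^+ 2)%R] ->
  y%:E <= err_rms P alpha gamma A.
Proof.
move=> fP y0 yE; apply: le_ereal_sup_tmp.
exists (sqrte 'E_P[(fun w => normc (A f w - cube_integral f) ^+ 2)%R]).
  by exists f.
have -> : y%:E = sqrte (y ^+ 2)%:E by rewrite /= sqrtr_sqr ger0_norm.
by rewrite lee_sqrt// (le_trans _ yE)// lee_fin sqr_ge0.
Qed.

Lemma err_ran_pr_le_rms (z : d.-tuple int) (p : {RV P >-> nat}) :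
  err_ran P alpha gamma (Q_ran_pr z p) <= err_rms P alpha gamma (Q_ran_pr z p).
Proof.
apply: ge_ereal_sup => _ [f fP <-]; apply: le_ereal_sup_tmp.
exists (sqrte 'E_P[(fun w => normc (Q_ran_pr z p f w - cube_integral f) ^+ 2)%R]).
  by exists f.
apply: expectation_le_sqrte => [|w]; last exact: normc_ge0.
(* The error of the unshifted rule depends on w only through the discrete variable [p], hence is
   measurable for every f. *)
exact: (@measurable_fun_index _ _ _ P p (fun m _ =>
  normc (lattice_rule m z [tuple 0%R | _ < d] f - cube_integral f))%R).
Qed.

End error_measures.

(** * Assembly of the lower bounds *)

Theorem theorem2 (R : realType) (d : nat) (hd : (0 < d)%N)
    (alpha : R) (halpha : 0 <= alpha)
    (gamma : {fset nat} -> R)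
    (hgamma : forall u : {fset nat}, 0%N \notin u -> 0 < gamma u)
    (C2 : R) (hC2 : 0 < C2)
    (hprimes : forall m : nat, (2 <= m)%N ->
       #|` prime_set m|%:R <= C2 * m%:R / ln m%:R)
    (n : nat) (hn : (2 <= n)%N) (z : d.-tuple int)
    (disp : measure_display) (Omega : measurableType disp)
    (P : probability Omega R)
    (p : {RV P >-> nat}) (hp : uniform_fset (prime_set n) p) :
  let bound : R :=
    gamma [fset 1%N]%fset * Num.sqrt (ln n%:R) /
      (Num.sqrt C2 * n%:R `^ (alpha + 2^-1)) in
  [/\ (err_ran P alpha gamma (Q_ran_pr z p) <=
         err_rms P alpha gamma (Q_ran_pr z p))%E,
      (bound%:E <= err_ran P alpha gamma (Q_ran_pr z p))%E &
      forall Delta : {RV P >-> Rtuple R d},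
        uniform_cube Delta -> independent_RV p Delta ->
        (bound%:E <= err_rms P alpha gamma (Q_ran_pr_sh z p Delta))%E /\
        ((forall q : nat, q \in prime_set n ->
            coprimez (tnth z (Ordinal hd)) q%:Z) ->
         (bound%:E <= err_ran P alpha gamma (Q_ran_pr_sh z p Delta))%E)].
Proof.
move=> bound.
pose i := Ordinal hd; pose S : seq nat := enum_fset (prime_set n).
pose N := #|` prime_set n|.
pose c := amplitude alpha (gamma [fset 1%N]%fset) N n.
have g0 : 0 < gamma [fset 1%N]%fset by apply: hgamma; rewrite inE.
have N0 : (0 < N)%N := uniform_fset_gt0 hp.
have bc : (bound%:E <= c%:E)%E.
  by rewrite lee_fin bound_le_amplitude// hprimes.
have c0 : 0 < c.
  rewrite divr_gt0// mulr_gt0 ?sqrtr_gt0 ?ltr0n//.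
  by apply: powR_gt0; rewrite ltr0n (leq_trans _ hn).
have ball s a : uniq s -> (size s <= N)%N ->
    {in s, forall k, a k ^+ 2 = c ^+ 2 /\ (0 < `|k| <= n)%N} ->
    korobov_space alpha gamma (trig_poly i s a) /\
    (korobov_norm alpha gamma (trig_poly i s a) <= 1)%E.
  move=> us sN sP; apply: korobov_ball_trig_poly.
  exact: (@korobov_norm_trig_poly_le1 _ _ _ _ i s a c n N).
have int0 s a : {in s, forall k, a k ^+ 2 = c ^+ 2 /\ (0 < `|k| <= n)%N} ->
    cube_integral (trig_poly i s a) = 0.
  by move=> sP; apply: cube_integral_trig_poly; apply/negP => /sP[].
have PS q : q \in S -> prime q /\ (q <= n)%N by exact: prime_setP.
(* [p] lies in P_n only almost surely, so pointwise error bounds are proved on this event of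
   probability 1. *)
pose A := p @^-1` [set` prime_set n].
have mA : measurable A by rewrite -[X in measurable X]setTI; exact: measurable_funPT.
have PA : P A = 1%E := uniform_fset_prob1 hp.
(* The polynomial with all primes of P_n as frequencies; it settles every bound except the root mean
   square one when a prime of P_n divides z_1. *)
pose s1 := [seq Posz q | q <- S]; pose a1 := fun _ : int => c.
have us1 : uniq s1 by rewrite map_inj_uniq ?fset_uniq// => ? ? [].
have ss1 : (size s1 <= N)%N by rewrite size_map.
have s1P : {in s1, forall k, a1 k ^+ 2 = c ^+ 2 /\ (0 < `|k| <= n)%N}.
  by move=> _ /mapP[q /PS[pq qn] ->]; split; rewrite //= prime_gt0.
have ball1 := ball _ _ us1 ss1 s1P; have int1 := int0 _ _ s1P.
have single1 q Delta : q \in S -> ~~ (q %| tnth z i)%Z ->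
    normc (lattice_rule q z Delta (trig_poly i s1 a1)) = c.
  move=> qS qz; have [pq _] := PS _ qS.
  rewrite normc_lattice_rule_single ?prime_gt0 ?map_f// ?ger0_norm ?ltW//.
  by move=> _ /mapP[k /PS[pk _] ->] /prime_dvdz_mul -> .
split; first exact: err_ran_pr_le_rms.
  apply: (le_trans bc); apply: le_err_ran ball1 _.
  apply: (expectation_ge_cst mA PA) => [|w|w Aw]; [exact: ltW|exact: normc_ge0|].
  have [pq _] := PS _ Aw.
  by rewrite int1 subr0 le_normc_lattice_rule_unshifted ?prime_gt0 ?ltW ?map_f.
move=> Delta _ _; split; last first.
  move=> cop; apply: (le_trans bc); apply: le_err_ran ball1 _.
  apply: (expectation_ge_cst mA PA) => [|w|w Aw]; [exact: ltW|exact: normc_ge0|].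
  have [pq _] := PS _ Aw.
  by rewrite int1 subr0 single1// prime_ndvdz_of_coprimez ?cop.
have [Sz|] := boolP (all (fun q : nat => ~~ (q %| tnth z i)%Z) S).
  apply: (le_trans bc); apply: le_err_rms ball1 (ltW c0) _.
  apply: (expectation_ge_cst mA PA) => [|w|w Aw]; rewrite ?sqr_ge0//.
  have [pq _] := PS _ Aw.
  by rewrite int1 subr0 single1// (allP Sz).
move=> /allPn[q0 q0S]; rewrite negbK => q0z.
(* [S'] is the set written S in the overview, whereas [S] lists all of P_n. The number e will be 1
   or -1, the sign of the term of frequency 1. *)
pose S' := [seq q : nat <- S | ~~ (q %| tnth z i)%Z].
pose s2 : seq int := 1 :: [seq Posz q | q <- S'].
pose a2 (e : R) (k : int) := if k == 1 then e * c else c.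
have one_notin : 1 \notin [seq Posz q | q <- S'].
  by apply/mapP => -[q]; rewrite mem_filter => /andP[_ /PS[pq _]] [q1]; rewrite -q1 in pq.
have us2 : uniq s2.
  rewrite /= one_notin map_inj_uniq ?filter_uniq ?fset_uniq//.
  by move=> ? ? [].
(* The prime [q0] divides z_1 and so is missing from [S']; this leaves room for the frequency 1. *)
have ss2 : (size s2 <= N)%N.
  rewrite /= size_map size_filter /N -(count_predC (fun q : nat => (q %| tnth z i)%Z) S).
  by rewrite -add1n leq_add2r -has_count; apply/hasP; exists q0.
have s2P e : e ^+ 2 = 1 -> {in s2, forall k, a2 e k ^+ 2 = c ^+ 2 /\ (0 < `|k| <= n)%N}.
  move=> e1 k; rewrite inE /a2 => /predU1P[->|].
    by rewrite eqxx exprMn e1 mul1r/=; split => //; exact: ltnW.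
  move=> ks; rewrite ifF; last by apply: contraNF one_notin => /eqP <-.
  split=> //; case/mapP: ks => q; rewrite mem_filter => /andP[_ /PS[pq qn]] ->.
  by rewrite /= prime_gt0.
(* The test polynomials have integral 0, so [X e] is the squared error for the sign e; one sign with
   mean at least c^2 suffices. *)
pose X e w : R := normc (Q_ran_pr_sh z p Delta (trig_poly i s2 (a2 e)) w) ^+ 2.
suff [e e1 Ee] : exists2 e : R, e ^+ 2 = 1 & ((c ^+ 2)%:E <= 'E_P[X e])%E.
  have ball2 := ball _ _ us2 ss2 (s2P _ e1); have int2 := int0 _ _ (s2P _ e1).
  apply: (le_trans bc); apply: le_err_rms ball2 (ltW c0) _.
  by rewrite int2; under [X in ('E_P[X])%E]eq_fun do rewrite subr0.
have X0 e w : 0 <= X e w by rewrite sqr_ge0.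
have mX e : measurable_fun setT (X e).
  apply: (@measurable_fun_index _ _ _ P p (fun m w =>
    normc (lattice_rule m z (Delta w) (trig_poly i s2 (a2 e))) ^+ 2)) => m.
  by apply: measurable_normc_lattice_rule_trig_poly; exact: measurable_funPT.
have XX w : A w -> 2 * c ^+ 2 <= X 1 w + X (-1) w.
  move=> Aw; have [pq _] := PS _ Aw; rewrite /X /Q_ran_pr_sh.
  (* If p does not divide z_1, the frequency 1 is killed along with all primes other than p, and
     both signs give error exactly c. *)
  have [qz|qz] := boolP (p w %| tnth z i)%Z; last first.
    have pS' : Posz (p w) \in s2.
      by rewrite inE map_f ?orbT// mem_filter qz Aw.
    have ap e : a2 e (p w) = c.
      by rewrite /a2 ifF//; apply/eqP => -[p1]; rewrite p1 in pq.
    have s2q : {in s2, forall k, (p w %| k * tnth z i)%Z -> k = p w}.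
      move=> k; rewrite inE => /predU1P[->|/mapP[r]].
        by rewrite mul1r (negbTE qz).
      by rewrite mem_filter => /andP[_ /PS[pr _]] -> /prime_dvdz_mul ->.
    rewrite !normc_lattice_rule_single ?prime_gt0 ?ap//.
    by rewrite ger0_norm ?(ltW c0)// mulr_natl mulr2n.
  (* Here p divides z_1, so every frequency survives: the rule gives V + U or V - U, where U comes
     from the frequency 1 and has modulus c. *)
  pose V := trig_poly i [seq Posz q | q <- S'] (fun=> c) (Delta w).
  pose U := c%:C * expi (2 * pi * (1%:~R * tnth (Delta w) i)).
  have LE e : lattice_rule (p w) z (Delta w) (trig_poly i s2 (a2 e)) = e%:C * U + V.
    rewrite lattice_rule_trig_poly ?prime_gt0// (_ : [seq k <- s2 | _] = s2).
      rewrite /V /trig_poly big_cons /a2 eqxx rmorphM/=; congr (_ + _).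
        by rewrite /U !mulrA.
      apply: eq_big_seq => k ks; rewrite ifF//.
      by apply: contraNF one_notin => /eqP <-.
    by apply/all_filterP/allP => k _; rewrite dvdz_mull.
  rewrite !LE mul1r [(-1)%:C]rmorphN rmorph1 mulN1r.
  apply: le_trans (parallelogram_ge U V).
  by rewrite /U normcM normc_expi mulr1 normc_real ger0_norm ?(ltW c0).
(* The two mean square errors add up to at least 2 c^2, so they cannot both be below c^2. *)
have : ((2 * c ^+ 2)%:E <= 'E_P[(X 1)%R] + 'E_P[(X (-1))%R])%E.
  apply: (@le_trans _ _ ('E_P[(fun w => X 1 w + X (-1) w)%R])%E).
    apply: (expectation_ge_cst mA PA) => // [|w]; last by rewrite addr_ge0.
    by rewrite mulr_ge0// sqr_ge0.
  rewrite unlock; under eq_integral do rewrite EFinD.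
  rewrite ge0_integralD//; try (by move=> w _; rewrite lee_fin).
  - exact/measurable_EFinP.
  - exact/measurable_EFinP.
have [|lt1] := leP (c ^+ 2)%:E ('E_P[(X 1)%R])%E; first by exists 1; rewrite ?expr1n.
have [|lt2] := leP (c ^+ 2)%:E ('E_P[(X (-1))%R])%E.
  by exists (-1); rewrite ?sqrrN ?expr1n.
by rewrite leNgt mulr2n mulrDl mul1r EFinD lteD.
Qed.
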